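(* Fix a base $B>1$, an integer $m\ge1$, and real numbers $a<b\le0$. Let $P_i^{(j)}$, $1\le i\le m$, $j\ge1$, be independent identically distributed random variables such that $\log_B P_i^{(j)}$ is uniformly distributed on $(a,b)$. Then the maximum side lengths $$\mathfrak{m}_1^{(n)}:=\max_{1\le i\le m}P_i^{(1)}P_i^{(2)}\cdots P_i^{(n)}$$ converge to strong Benford behavior in base $B$ as $n\to\infty$.
   Context: Significand: for $x>0$, $S_B(x)$ is the unique number in $[1,B)$ with $\log_B x-\log_B S_B(x)\in\mathbb{Z}$. A sequence of positive random variables $X^{(n)}$ converges to strong Benford behavior in base $B$ if $\mathbb{P}(S_B(X^{(n)})\le D)\to\log_B D$ for every $D\in[1,B]$. *)

(* Defs.v *)
From HB Require Import structures.
From mathcomp Require Import all_boot all_order all_algebra.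
From mathcomp Require Import all_classical all_reals all_analysis.
Set Implicit Arguments. Unset Strict Implicit. Unset Printing Implicit Defensive.
Import Order.TTheory GRing.Theory Num.Theory.
Local Open Scope classical_set_scope.
Local Open Scope ring_scope.

Definition logB (R : realType) (B x : R) : R := ln x / ln B.

(** significand S_B(x): for x > 0 the unique number in [1,B) with
    log_B x - log_B S_B(x) an integer, written out explicitly as
    B ^ (log_B x - floor (log_B x)). *)
Definition significand (R : realType) (B x : R) : R :=
  B `^ (logB B x - (Num.floor (logB B x))%:~R).

Definition mutually_independent d (T : measurableType d) (R : realType)
  (P : probability T R) (I : eqType) (X : I -> T -> R) : Prop :=
  forall (s : seq I) (A : I -> set R), uniq s -> (forall i, measurable (A i)) ->
  P (\big[setI/setT]_(i <- s) (X i @^-1` A i)) =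
  (\prod_(i <- s) P (X i @^-1` A i))%E.

Definition log_uniform d (T : measurableType d) (R : realType)
  (P : probability T R) (B a b : R) (ab : a < b) (X : T -> R) : Prop :=
  forall A : set R, measurable A ->
    P ((fun w => logB B (X w)) @^-1` A) = uniform_prob ab A.

Definition strong_Benford d (T : measurableType d) (R : realType)
  (P : probability T R) (B : R) (Xn : nat -> T -> R) : Prop :=
  forall D : R, 1 <= D <= B ->
    (fun n => P [set w | significand B (Xn n w) <= D]) @ \oo
      --> (logB B D)%:E.

(* Main.v *)
(** A translation (Mineka) coupling shows that the law of the logarithm of the
    maximum is asymptotically invariant under the shift by [t = 1 / N], and a
    law on the circle which is almost invariant under the shift by [1 / N]
    gives almost equal masses to the [N] arcs of length [1 / N].

    For the invariance, couple a step [y] of the walk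
    [log_B P_i^(1) + ... + log_B P_i^(n)] with the step in which the cells
    [[a, a + t[] and [[a + t, a + 2 t[] are exchanged.  The difference of the
    two walks, counted in units of [t] and started at [k], is a lazy simple
    random walk, and the walks agree once it hits [0].  Hence the distance
    between the law of the walk and its shift by [k t] is at most any
    supersolution of the recursion of the lazy walk that dominates the initial
    distance and the boundary values at [0] and [K], such as
    [k / K + rho ^ n k (K - k)] with [rho < 1], which for [k = 1] is small when
    [K] and then [n] are large.  The rows are independent, so shifting them one
    at a time shifts the maximum at [m] times this cost. *)
Require Import Defs.
From HB Require Import structures.
From mathcomp Require Import all_boot all_order all_algebra.
From mathcomp Require Import all_classical all_reals all_analysis.
From mathcomp Require Import measurable_realfun.
From mathcomp Require Import ring lra.
Import Order.TTheory GRing.Theory Num.Theory.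
Local Open Scope classical_set_scope.
Local Open Scope ring_scope.

(** * Translating Lebesgue integrals and exchanging two cells of a uniform law *)

Lemma ge0_le_integralD_cst d (T : measurableType d) (R : realType)
    (mu : {measure set T -> \bar R}) (D : set T) (f g : T -> \bar R) (c : R) :
  measurable D -> measurable_fun D f -> measurable_fun D g ->
  (forall x, 0 <= f x)%E -> (forall x, 0 <= g x)%E -> 0 <= c ->
  (forall x, f x <= g x + c%:E)%E ->
  (\int[mu]_(x in D) f x <= \int[mu]_(x in D) g x + c%:E * mu D)%E.
Proof.
move=> mD mf mg f0 g0 c0 fg.
rewrite -integral_cst// -ge0_integralD//=.
apply: ge0_le_integral => //.
by apply: emeasurable_funD.
Qed.

Lemma preimage_addr_itv (R : realType) (b0 b1 : bool) (x y t : R) :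
  (+%R^~ t : R -> R) @^-1` [set` Interval (BSide b0 (x + t)) (BSide b1 (y + t))] =
  [set` Interval (BSide b0 x) (BSide b1 y)].
Proof.
by apply/seteqP; split => z /=; rewrite !in_itv /=;
  case: b0; case: b1; rewrite /= ?lerD2r ?ltrD2r.
Qed.

(** Lebesgue measure is determined by the lengths of half-open intervals, which a translation
    preserves. *)
Lemma lebesgue_measure_addr (R : realType) (t : R) (A : set R) : measurable A ->
  pushforward lebesgue_measure (+%R^~ t : R -> measurableTypeR R) A =
  lebesgue_measure A.
Proof.
have mt : measurable_fun [set: R] (+%R^~ t : R -> measurableTypeR R).
  exact: measurable_funD.
pose f : {mfun R >-> measurableTypeR R} := HB.pack (+%R^~ t : R -> measurableTypeR R)
  (isMeasurableFun.Build _ _ _ _ _ mt).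
move=> mA; apply/esym.
apply: (@lebesgue_measure_unique R (pushforward lebesgue_measure f)) => //= _ [[x y]] _ <-.
rewrite /pushforward /= -[x in _ @^-1` `]x, _]](subrK t) -[y in _ @^-1` `]_, y]](subrK t).
rewrite preimage_addr_itv !lebesgue_measure_itv/= !lte_fin ltrD2r.
by case: ifP => // _; rewrite -!EFinB; congr _%:E; ring.
Qed.

Lemma ge0_integral_addr (R : realType) (x y t : R) (f : R -> \bar R) :
  measurable_fun setT f -> (forall r, 0 <= f r)%E ->
  (\int[lebesgue_measure]_(r in `[(x + t)%R, (y + t)%R[) f r =
   \int[lebesgue_measure]_(r in `[x, y[) f (r + t)%R)%E.
Proof.
move=> mf f0.
have mt : measurable_fun [set: measurableTypeR R]
    (+%R^~ t : measurableTypeR R -> measurableTypeR R) by exact: measurable_funD.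
rewrite -(preimage_addr_itv R true true x y t).
rewrite -(ge0_integral_pushforward mt lebesgue_measure)//=; last exact: measurable_funTS.
by apply: eq_measure_integral => A mA _; apply/esym/lebesgue_measure_addr.
Qed.

(* [phi] and [psi] are compared after exchanging the cells [[a, a + t[] and
   [[a + t, a + 2 t[], each of mass [t / (b - a)], in the law of the argument
   of [phi]. *)
Lemma uniform_exchange (R : realType) (a b t : R) (ab : a < b)
    (phi psi : R -> \bar R) (dl dr d0 : R) :
  0 < t -> a + t + t <= b ->
  measurable_fun setT phi -> measurable_fun setT psi ->
  (forall y, 0 <= phi y)%E -> (forall y, 0 <= psi y)%E ->
  0 <= dl -> 0 <= dr -> 0 <= d0 ->
  (forall y, psi y <= phi y + d0%:E)%E ->
  (forall y, psi y <= phi (y + t)%R + dl%:E)%E ->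
  (forall y, psi (y + t)%R <= phi y + dr%:E)%E ->
  (\int[uniform_prob ab]_y psi y <= \int[uniform_prob ab]_y phi y +
    (t / (b - a) * (dl + dr) + (1 - 2 * (t / (b - a))) * d0)%:E)%E.
Proof.
move=> t0 atb mphi mpsi phi0 psi0 dl0 dr0 d00 h0 hl hr.
have ba0 : 0 < b - a by rewrite subr_gt0.
pose C1 := `[a, a + t[%classic; pose C2 := `[a + t, a + t + t[%classic.
pose C3 := `[a + t + t, b]%classic.
have m1 : measurable C1 by exact: measurable_itv.
have m2 : measurable C2 by exact: measurable_itv.
have m3 : measurable C3 by exact: measurable_itv.
have split3 (f : R -> \bar R) : measurable_fun setT f -> (forall y, 0 <= f y)%E ->
   (\int[lebesgue_measure]_(y in `[a, b]) f y =
    \int[lebesgue_measure]_(y in C1) f y + \int[lebesgue_measure]_(y in C2) f y +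
    \int[lebesgue_measure]_(y in C3) f y)%E.
  move=> mf f0.
  have -> : `[a, b]%classic = (C1 `|` C2) `|` C3.
    apply/seteqP; split => y /=; rewrite /C1 /C2 /C3 /= !in_itv /=; last by lra.
    move=> /andP[ay yb]; case: (ltP y (a + t)) => y1; first by left; left; lra.
    by case: (ltP y (a + t + t)) => y2; [left; right|right]; lra.
  rewrite ge0_integral_setU//; first last.
  - rewrite disj_set2E; apply/eqP/seteqP; split => y //=.
    by rewrite /C1 /C2 /C3 /= !in_itv /=; lra.
  - exact: measurable_funTS.
  - exact: measurableU.
  rewrite ge0_integral_setU//; first exact: measurable_funTS.
  rewrite disj_set2E; apply/eqP/seteqP; split => y //=.
  by rewrite /C1 /C2 /= !in_itv /=; lra.
rewrite !integral_uniform// !split3//.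
have mt : measurable_fun [set: R] (+%R^~ t : R -> R) by exact: measurable_funD.
have mphit : measurable_fun setT (fun y : R => phi (y + t)) by exact: measurableT_comp.
have mpsit : measurable_fun setT (fun y : R => psi (y + t)) by exact: measurableT_comp.
have lC1 : lebesgue_measure C1 = t%:E.
  by rewrite /C1 lebesgue_measure_itv/= lte_fin ltrDl t0 -EFinB; congr _%:E; ring.
have I1 : (\int[lebesgue_measure]_(y in C1) psi y <=
           \int[lebesgue_measure]_(y in C2) phi y + (dl * t)%:E)%E.
  rewrite ge0_integral_addr// EFinM -lC1.
  by apply: ge0_le_integralD_cst => //; apply: measurable_funTS.
have I2 : (\int[lebesgue_measure]_(y in C2) psi y <=
           \int[lebesgue_measure]_(y in C1) phi y + (dr * t)%:E)%E.
  rewrite ge0_integral_addr// EFinM -lC1.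
  by apply: ge0_le_integralD_cst => //; apply: measurable_funTS.
have I3 : (\int[lebesgue_measure]_(y in C3) psi y <=
           \int[lebesgue_measure]_(y in C3) phi y + (d0 * (b - a - 2 * t))%:E)%E.
  have -> : (d0 * (b - a - 2 * t))%:E = (d0%:E * lebesgue_measure C3)%E.
    (* When [a + t + t = b] the cell [C3] is a single point, and the factor [b - a - 2 * t] vanishes
       as well. *)
    rewrite /C3 lebesgue_measure_itv/= lte_fin; case: ltgtP atb => // [_|<-] _.
      by rewrite -EFinB -EFinM; congr _%:E; ring.
    by rewrite mule0; congr _%:E; ring.
  by apply: ge0_le_integralD_cst => //; apply: measurable_funTS.
have phi_ge0 C : (0 <= \int[lebesgue_measure]_(y in C) phi y)%E.
  exact: integral_ge0.
have -> : t / (b - a) * (dl + dr) + (1 - 2 * (t / (b - a))) * d0 =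
    (b - a)^-1 * (dl * t + dr * t + d0 * (b - a - 2 * t)).
  by field; rewrite gt_eqF.
rewrite EFinM -ge0_muleDr; first last.
- by rewrite lee_fin !addr_ge0// mulr_ge0// ?(ltW t0)//; lra.
- exact: adde_ge0 (adde_ge0 (phi_ge0 _) (phi_ge0 _)) (phi_ge0 _).
apply: lee_wpmul2l; first by rewrite lee_fin invr_ge0 ltW.
(* The cells cross: the first cell of [psi] is paired with the second one of [phi], and
   conversely. *)
have key (p1 p2 p3 s1 s2 s3 : \bar R) (x y z : R) : (s1 <= p2 + x%:E -> s2 <= p1 + y%:E ->
    s3 <= p3 + z%:E -> s1 + s2 + s3 <= p1 + p2 + p3 + (x + y + z)%:E)%E.
  move=> h1 h2 h3; apply: le_trans (leeD (leeD h1 h2) h3) _.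
  by rewrite !EFinD (addeACA p2) (addeC p2) [leLHS]addeACA.
exact: key.
Qed.

(** * Joint laws and the sigma-algebra of a set of coordinates *)

(** By uniqueness on rectangles, independence makes the law of the pair a product measure;
    evaluating it in the other order of integration leaves an integral over the value of [Y]. *)
Lemma joint_law {d d1 d2} {T : measurableType d} {T1 : measurableType d1}
    {T2 : measurableType d2} {R : realType} {P : probability T R}
    {mu : probability T2 R} {W : T -> T1} {Y : T -> T2} :
  measurable_fun setT W -> measurable_fun setT Y ->
  (forall E A, measurable E -> measurable A ->
    P (W @^-1` E `&` Y @^-1` A) = P (W @^-1` E) * mu A)%E ->
  forall E : set (T1 * T2), measurable E ->
  P ((fun w => (W w, Y w)) @^-1` E) = (\int[mu]_y P (W @^-1` ysection E y))%E.
Proof.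
move=> mW mY indep E mE.
have mWY : measurable_fun setT (fun w => (W w, Y w)) by exact: measurable_fun_pair.
pose W' : {mfun T >-> T1} := HB.pack W (isMeasurableFun.Build _ _ _ _ _ mW).
pose WY : {mfun T >-> (T1 * T2)%type} :=
  HB.pack (fun w => (W w, Y w)) (isMeasurableFun.Build _ _ _ _ _ mWY).
rewrite -[LHS]/(distribution P WY E) -[RHS]/((distribution P W' \x^ mu)%E E).
transitivity ((distribution P W' \x mu)%E E).
  by apply/esym/product_measure_unique => // A B mA mB.
apply: product_measure_unique => // A B mA mB.
exact: product_measure2E.
Qed.

Lemma bigsetIP {I : eqType} {T : Type} {s : seq I} {F : I -> set T} {w : T} :
  (\big[setI/setT]_(i <- s) F i) w <-> (forall i, i \in s -> F i w).
Proof.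
elim: s => [|j s IHs]; first by rewrite big_nil; split.
rewrite big_cons; split => [[Fj /IHs Fs] i|Fs].
  by rewrite inE => /predU1P[->//|/Fs].
split; first by apply: Fs; rewrite mem_head.
by apply/IHs => i si; apply: Fs; rewrite inE si orbT.
Qed.

(** A pi-system generating the sigma-algebra of the coordinates in [J]; measurability from
    [g_sigma_algebraType (cylinders X J)] encodes dependence on these coordinates only. *)
Definition cylinders {I : eqType} {T : Type} {d} {U : measurableType d}
    (X : I -> T -> U) (J : {pred I}) : set (set T) :=
  [set E | exists s A, [/\ {subset s <= J}, forall i, measurable (A i) &
    E = \big[setI/setT]_(i <- s) (X i @^-1` A i)]].

Section cylinders.
Context {d} {T : measurableType d} {R : realType} {P : probability T R}.
Context {I : eqType} {X : I -> T -> R} {J : {pred I}}.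
Hypothesis mX : forall i, measurable_fun setT (X i).

Lemma cylinders_setT : cylinders X J setT.
Proof. by exists [::], (fun=> setT); split => //; rewrite big_nil. Qed.

Lemma cylinders_setI : setI_closed (cylinders X J).
Proof.
move=> _ _ [s1 [A1 [J1 mA1 ->]]] [s2 [A2 [J2 mA2 ->]]].
exists (s1 ++ s2), (fun i => (if i \in s1 then A1 i else setT) `&`
                             (if i \in s2 then A2 i else setT)).
split.
- by move=> i; rewrite mem_cat => /orP[/J1|/J2].
- by move=> i; apply: measurableI; case: ifP.
apply/seteqP; split => w.
  move=> [/bigsetIP h1 /bigsetIP h2]; apply/bigsetIP => i _ /=.
  by split; case: ifPn => // si; [exact: h1|exact: h2].
move=> /bigsetIP h; split; apply/bigsetIP => i si; have := h i;
  by rewrite /= mem_cat si ?orbT => /(_ isT) [].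
Qed.

Lemma measurable_cylinders E : cylinders X J E -> measurable E.
Proof.
move=> [s [A [_ mA ->]]]; apply: bigsetI_measurable => i _.
by rewrite -[X in measurable X]setTI; exact: mX.
Qed.

Lemma measurable_cylinder_coord i : i \in J ->
  measurable_fun setT (X i : g_sigma_algebraType (cylinders X J) -> R).
Proof.
move=> iJ _ A mA; rewrite setTI; apply: sub_sigma_algebra.
exists [:: i], (fun=> A); split => //; last by rewrite big_seq1.
by move=> j; rewrite inE => /eqP ->.
Qed.

Hypothesis Xind : mutually_independent P X.

(** As functions of [E], both sides are finite measures that agree on the pi-system of cylinders,
    hence on the sigma-algebra it generates. *)
Lemma cylinders_indep {p E A} : p \notin J -> <<s cylinders X J >> E -> measurable A ->
  (P (E `&` X p @^-1` A) = P E * P (X p @^-1` A))%E.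
Proof.
move=> pJ sE mA.
have mXA : measurable (X p @^-1` A) by rewrite -[X in measurable X]setTI; exact: mX.
have r0 : 0 <= fine (P (X p @^-1` A)) by exact/fine_ge0.
rewrite muleC -(fineK (fin_num_measure P _ mXA)).
rewrite -[LHS]/(mrestr P mXA E) -[RHS]/(mscale (NngNum r0) P E).
apply: (g_sigma_algebra_measure_unique (cylinders X J) measurable_cylinders
  (fun=> setT) (fun=> cylinders_setT)) => //.
- by rewrite bigcup_const.
- exact: cylinders_setI.
(* Independence is stated for lists without repetition, hence [undup]; a repeated index carries the
   same set [B i], so the intersection is unchanged. *)
- move=> _ [s [B [sJ mB ->]]]; have -> : \big[setI/setT]_(i <- s) (X i @^-1` B i) =
            \big[setI/setT]_(i <- undup s) (X i @^-1` B i).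
    by apply/seteqP; split => w /bigsetIP h; apply/bigsetIP => i si;
      apply: h; rewrite ?mem_undup// -mem_undup.
  have sp i : i \in undup s -> i != p.
    by rewrite mem_undup => /sJ; apply: contraTneq => ->.
  (* The event at [p] joins the same family, so that independence applies to [p :: undup s]. *)
  pose B' i := if i == p then A else B i.
  have BB : \big[setI/setT]_(i <- undup s) X i @^-1` B i =
            \big[setI/setT]_(i <- undup s) X i @^-1` B' i.
    by apply: eq_big_seq => i /sp /negPf ip; rewrite /B' ip.
  have mB' i : measurable (B' i) by rewrite /B'; case: ifP.
  have up : uniq (p :: undup s).
    by rewrite /= undup_uniq andbT; apply/negP => /sp; rewrite eqxx.
  rewrite /= /mscale /mrestr /= fineK ?fin_num_measure// BB setIC.
  have := Xind _ _ up mB'; rewrite !big_cons {1 3}/B' eqxx => ->.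
  by rewrite Xind// undup_uniq.
- by move=> _; rewrite /= /mrestr setTI -ge0_fin_numE// fin_num_measure.
Qed.

Lemma cylinders_fun_indep {d1} {T1 : measurableType d1} {f : T -> T1} :
  measurable_fun setT (f : g_sigma_algebraType (cylinders X J) -> T1) ->
  measurable_fun setT f /\
  forall p E A, p \notin J -> measurable E -> measurable A ->
    (P (f @^-1` E `&` X p @^-1` A) = P (f @^-1` E) * P (X p @^-1` A))%E.
Proof.
move=> mf.
have sf E : measurable E -> <<s cylinders X J >> (f @^-1` E).
  by move=> mE; have := mf measurableT E mE; rewrite setTI.
split=> [_ E mE|p E A pJ mE mA]; last by apply: cylinders_indep => //; exact: sf.
rewrite setTI; apply: smallest_sub (sf _ mE); last exact: measurable_cylinders.
exact: sigma_algebra_measurable.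
Qed.

End cylinders.

(** * The supersolution of the lazy walk and the cost of shifting one walk *)

(* [1 - 2 q / K ^ 2] is the rate [rho] of the supersolution, [q] being the
   probability of a step up and that of a step down. *)
Definition walk_bound {R : realType} (q : R) (K n k : nat) : R :=
  k%:R / K%:R + (1 - 2 * q / K%:R ^+ 2) ^+ n * (k%:R * (K%:R - k%:R)).

Section walk_bound.
Context {R : realType} {q : R} {K : nat}.
Hypotheses (q0 : 0 <= q) (q12 : 2 * q <= 1) (K0 : (0 < K)%N).

Lemma walk_rate_ge0 : 0 <= 1 - 2 * q / K%:R ^+ 2.
Proof.
have K1 : 1 <= K%:R ^+ 2 :> R by rewrite expr_ge1// ler1n.
have -> : 1 - 2 * q / K%:R ^+ 2 = (K%:R ^+ 2 - 2 * q) / K%:R ^+ 2.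
  by field; rewrite pnatr_eq0 -lt0n.
by apply: divr_ge0 => //; rewrite subr_ge0 (le_trans q12).
Qed.

Lemma walk_bound_ge0 n k : (k <= K)%N -> 0 <= walk_bound q K n k.
Proof.
move=> kK; rewrite addr_ge0 ?divr_ge0// mulr_ge0 ?exprn_ge0 ?walk_rate_ge0//.
by rewrite mulr_ge0// subr_ge0 ler_nat.
Qed.

Lemma walk_bound_last n : walk_bound q K n K = 1.
Proof. by rewrite /walk_bound subrr !mulr0 addr0 divff// pnatr_eq0 -lt0n. Qed.

(** For [0 < k < K] the integer [k * (K - k)] is at least [1], which covers the trivial bound on the
    distance at time [0]. *)
Lemma walk_bound0_ge1 k : (0 < k <= K)%N -> 1 <= walk_bound q K 0 k.
Proof.
case/andP=> k0; rewrite leq_eqVlt => /predU1P[->|kK]; first by rewrite walk_bound_last.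
rewrite /walk_bound expr0 mul1r ler_wpDl ?divr_ge0//.
by rewrite -natrB ?(ltnW kK)// -natrM ler1n muln_gt0 k0 subn_gt0.
Qed.

(* The linear term is harmonic for the walk, and the second difference of
   [k * (K - k)] is [-2], at least [2 / K ^ 2] of its value. *)
Lemma walk_boundS n k : (k.+1 < K)%N ->
  q * (walk_bound q K n k + walk_bound q K n k.+2) + (1 - 2 * q) * walk_bound q K n k.+1
  <= walk_bound q K n.+1 k.+1.
Proof.
move=> kK.
have Kn0 : K%:R != 0 :> R by rewrite pnatr_eq0 -lt0n.
rewrite /walk_bound (exprS _ n); set r := 1 - 2 * q / K%:R ^+ 2; set s := r ^+ n.
have s0 : 0 <= s by rewrite exprn_ge0// walk_rate_ge0.
pose v : R := k.+1%:R * (K%:R - k.+1%:R).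
have hv : v <= K%:R ^+ 2.
  rewrite expr2 ler_pM// ?subr_ge0 ?ler_nat ?(ltnW kK)//.
  by rewrite gerBl.
rewrite -subr_ge0 [leRHS](_ : _ = s * (2 * q * (1 - v / K%:R ^+ 2))); last first.
  by rewrite /v /r -(natr1 k.+1) -(natr1 k); field.
rewrite !mulr_ge0// subr_ge0 ler_pdivrMr ?mul1r//.
by rewrite exprn_gt0// ltr0n.
Qed.

End walk_bound.

(** Induction on [n], integrating over the last step: exchanging the two cells there turns the
    distance [k] into [k - 1] or [k + 1], with probability [t / (b - a)] each. The spectator [C] is
    later the maximum over the other rows. *)
Lemma walk_shift {d} {T : measurableType d} {R : realType} {P : probability T R}
    {a b t : R} {ab : a < b} {C : T -> R} {Y : nat -> T -> R} {K : nat} :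
  0 < t -> a + t + t <= b -> measurable_fun setT C ->
  (forall j, measurable_fun setT (Y j)) ->
  (forall n (E : set (R * R)) A, measurable E -> measurable A ->
    P ((fun w => (C w, (\sum_(j < n) Y j w)%R)) @^-1` E `&` Y n @^-1` A) =
    P ((fun w => (C w, (\sum_(j < n) Y j w)%R)) @^-1` E) * uniform_prob ab A)%E ->
  (0 < K)%N -> forall n k (E : set (R * R)), (k <= K)%N -> measurable E ->
  (P [set w | E (C w, (\sum_(j < n) Y j w + k%:R * t)%R)] <=
   P [set w | E (C w, (\sum_(j < n) Y j w)%R)] + (walk_bound (t / (b - a)) K n k)%:E)%E.
Proof.
move=> t0 atb mC mY indep K0; set q := t / (b - a).
have q0 : 0 <= q by rewrite divr_ge0 ?subr_ge0 ?(ltW ab)// ltW.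
have q12 : 2 * q <= 1 by rewrite /q mulrA ler_pdivrMr ?subr_gt0// mul1r; lra.
have mS n : measurable_fun setT (fun w => \sum_(j < n) Y j w) by exact: measurable_sum.
have mCS n : measurable_fun setT (fun w => (C w, \sum_(j < n) Y j w)).
  exact: measurable_fun_pair.
have bound_ge1 n k (A B : set T) : measurable A -> 1 <= walk_bound q K n k ->
    (P A <= P B + (walk_bound q K n k)%:E)%E.
  move=> mA h; apply: (@le_trans _ _ 1%E); first exact: probability_le1.
  by apply: (@le_trans _ _ (walk_bound q K n k)%:E); rewrite ?lee_fin// leeDr.
have mshift n k (E : set (R * R)) : measurable E ->
    measurable [set w | E (C w, \sum_(j < n) Y j w + k)].
  move=> mE; rewrite -[X in measurable X]setTI.
  apply: (_ : measurable_fun setT (fun w => (C w, \sum_(j < n) Y j w + k))) => //.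
  by apply: measurable_fun_pair => //; exact: measurable_funD.
elim=> [|n IHn] k E kK mE.
  case: k kK => [|k] kK; last by apply: bound_ge1; [exact: mshift|exact: walk_bound0_ge1].
  rewrite mul0r; under eq_set do rewrite addr0.
  by rewrite leeDl// lee_fin walk_bound_ge0.
(* At the two ends nothing is exchanged: the events coincide at [0], and the bound is [1] at [K]. *)
case: k kK => [|k] kK.
  rewrite mul0r; under eq_set do rewrite addr0.
  by rewrite leeDl// lee_fin walk_bound_ge0.
move: (kK); rewrite leq_eqVlt => /predU1P[->|kK'].
  by apply: bound_ge1; [exact: mshift|rewrite walk_bound_last].
(* [F] displaces the walk after [n] steps; integrating [F (y + u)] over the last step [y] gives the
   walk after [n.+1] steps displaced by [u]. *)
pose F u := P [set w | E (C w, \sum_(j < n) Y j w + u)].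
have mE' u : measurable [set z : (R * R) * R | E (z.1.1, z.1.2 + (z.2 + u))].
  rewrite -[X in measurable X]setTI.
  apply: (_ : measurable_fun setT
    (fun z : (R * R) * R => (z.1.1, z.1.2 + (z.2 + u)))) => //.
  apply: measurable_fun_pair; first exact: measurableT_comp.
  apply: measurable_funD; first exact: measurableT_comp.
  exact: measurable_funD.
have FE u y : F (y + u) =
    P ((fun w => (C w, \sum_(j < n) Y j w)) @^-1`
       ysection [set z : (R * R) * R | E (z.1.1, z.1.2 + (z.2 + u))] y).
  by congr (P _); apply/seteqP; split => w /=; rewrite /ysection /= inE.
have step u : P [set w | E (C w, \sum_(j < n.+1) Y j w + u)] =
    (\int[uniform_prob ab]_y F (y + u)%R)%E.
  under eq_integral do rewrite FE.
  rewrite -(joint_law (mu := uniform_prob ab) (mCS n) (mY n) (indep n)).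
    by congr (P _); apply/seteqP; split => w /=; rewrite big_ord_recr/= addrA.
  exact: mE' u.
have FD u j : (j <= K)%N -> (F (u + j%:R * t)%R <= F u + (walk_bound q K n j)%:E)%E.
  move=> jK; have mEu : measurable [set z : R * R | E (z.1, z.2 + u)].
    rewrite -[X in measurable X]setTI.
    apply: (_ : measurable_fun setT (fun z : R * R => (z.1, z.2 + u))) => //.
    by apply: measurable_fun_pair => //; exact: measurable_funD.
  have := IHn j _ jK mEu; rewrite /=.
  by under [X in (P X <= _)%E -> _]eq_set do rewrite -addrA (addrC _ u).
have mF u : measurable_fun setT (fun y : R => F (y + u)).
  pose W : {mfun T >-> (R * R)%type} := HB.pack (fun w => (C w, \sum_(j < n) Y j w))
    (isMeasurableFun.Build _ _ _ _ _ (mCS n)).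
  under eq_fun do rewrite FE.
  exact: (measurable_fun_ysection (distribution P W) (mE' u)).
have step0 : P [set w | E (C w, \sum_(j < n.+1) Y j w)] =
    (\int[uniform_prob ab]_y F y)%E.
  have := step 0; under eq_set do rewrite addr0.
  by under eq_integral do rewrite addr0.
rewrite step step0; apply: le_trans.
  (* The displacement left is [k], [k.+2] or [k.+1] units of [t], as the argument of [F] is moved
     up, moved down or left alone. *)
  apply: (@uniform_exchange _ _ _ t ab (fun y => F y) (fun y => F (y + k.+1%:R * t))
    (walk_bound q K n k) (walk_bound q K n k.+2) (walk_bound q K n k.+1)) => //.
  - by have := mF 0; under eq_fun do rewrite addr0.
  - exact/walk_bound_ge0/ltnW.
  - exact/walk_bound_ge0.
  - exact/walk_bound_ge0.
  - by move=> y; exact: FD.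
  - move=> y; have -> : y + k.+1%:R * t = y + t + k%:R * t by rewrite -natr1; ring.
    by apply: FD; exact: ltnW.
  - move=> y; have -> : y + t + k.+1%:R * t = y + k.+2%:R * t.
      by rewrite -(natr1 k.+1); ring.
    exact: FD.
by apply: leeD => //; rewrite lee_fin; exact: walk_boundS.
Qed.
(** [K] is fixed first, to make the linear term at most [eps / 2]; the geometric term then tends to
    [0] with [n]. *)
Lemma walk_bound1_small {R : realType} {q eps : R} :
  0 < q -> 2 * q <= 1 -> 0 < eps ->
  exists2 K, (0 < K)%N & \forall n \near \oo, walk_bound q K n 1 <= eps.
Proof.
move=> q0 q12 e0.
pose K := (Num.truncn (2 / eps)).+1.
have K0 : 0 < K%:R :> R by rewrite ltr0n.
have hK : 1 / K%:R <= eps / 2.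
  rewrite ler_pdivrMr// mulrAC ler_pdivlMr// mul1r mulrC -ler_pdivrMr//.
  exact/ltW/truncnS_gt.
exists K => //.
have r0 : 0 <= 1 - 2 * q / K%:R ^+ 2 by exact: walk_rate_ge0.
have r1 : `|1 - 2 * q / K%:R ^+ 2| < 1.
  by rewrite ger0_norm// gtrBl divr_gt0 ?exprn_gt0//; lra.
(* At [k = 1] the power is multiplied by [K - 1], which is below [K]. *)
have e2 : 0 < eps / 2 / K%:R by rewrite !divr_gt0.
have /cvgrPdist_le/(_ _ e2) := cvg_expr r1; apply: filterS => n.
rewrite sub0r normrN ger0_norm ?exprn_ge0// => hn; rewrite /walk_bound.
rewrite [leRHS](splitr eps); apply: lerD => //.
have -> : eps / 2 = eps / 2 / K%:R * K%:R by rewrite mulfVK// gt_eqF.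
by rewrite mul1r ler_pM ?exprn_ge0 ?r0 ?subr_ge0 ?ler1n ?gerBl.
Qed.

(** * Almost invariant laws on the circle *)

(** One-sided inequalities suffice on a cycle: going up from [0] to [r] bounds [p 0] by [p r], and
    going on from [r] to [N] and back to [0] bounds [p r] by [p 0], each at a cost of at most [N.+1]
    times [eta]. *)
Lemma cyclic_almost_uniform {R : realFieldType} {p : nat -> R} {N : nat} {eta : R} :
  0 <= eta -> (forall r, (r < N)%N -> p r <= p r.+1 + eta) -> p N <= p 0%N + eta ->
  \sum_(r < N.+1) p r = 1 ->
  forall k, (k <= N.+1)%N ->
  `|\sum_(r < k) p r - k%:R / N.+1%:R| <= 2 * N.+1%:R ^+ 2 * eta.
Proof.
move=> eta0 pS pN p1 k kN.
have up r j : (r + j <= N)%N -> p r <= p (r + j)%N + j%:R * eta.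
  elim: j => [|j IHj] rj; first by rewrite addn0 mul0r addr0.
  rewrite addnS in rj *; apply: le_trans (IHj (ltnW rj)) _.
  by have := pS _ rj; rewrite -natr1; lra.
have N0 : 0 < N.+1%:R :> R by rewrite ltr0n.
have close r : (r <= N)%N -> `|p r - p 0%N| <= N.+1%:R * eta.
  move=> rN; rewrite ler_distl; apply/andP; split.
    have := up 0%N r; rewrite add0n => /(_ rN) h.
    rewrite lerBlDr (le_trans h)// lerD2l ler_wpM2r// ler_nat; exact: leqW.
  have := up r (N - r)%N; rewrite subnKC// => /(_ (leqnn _)) h.
  have hr : (N - r)%:R * eta <= N%:R * eta by rewrite ler_wpM2r// ler_nat leq_subr.
  by rewrite -natr1 mulrDl mul1r; lra.
have sums j : (j <= N.+1)%N ->
    `|\sum_(r < j) p r - j%:R * p 0%N| <= N.+1%:R ^+ 2 * eta.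
  move=> jN; have -> : \sum_(r < j) p r - j%:R * p 0%N = \sum_(r < j) (p r - p 0%N).
    by rewrite sumrB sumr_const card_ord mulr_natl.
  apply: le_trans (ler_norm_sum _ _ _) _.
  apply: (@le_trans _ _ (\sum_(r < j) N.+1%:R * eta)).
    by apply: ler_sum => r _; apply: close; rewrite -ltnS (leq_trans (ltn_ord r)).
  rewrite sumr_const card_ord -[leLHS]mulr_natl expr2 -mulrA ler_wpM2r ?ler_nat//.
  by rewrite mulr_ge0.
have h1 := sums _ (leqnn _); rewrite p1 in h1.
have hk := sums _ kN.
(* The total mass [1] eliminates [p 0]; each of the two terms costs at most [N.+1 ^ 2 * eta]. *)
have -> : \sum_(r < k) p r - k%:R / N.+1%:R =
    (\sum_(r < k) p r - k%:R * p 0%N) - k%:R / N.+1%:R * (1 - N.+1%:R * p 0%N).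
  by field; rewrite gt_eqF.
apply: le_trans (ler_normB _ _) _.
have -> : 2 * N.+1%:R ^+ 2 * eta = N.+1%:R ^+ 2 * eta + N.+1%:R ^+ 2 * eta by ring.
apply: lerD => //.
rewrite normrM ger0_norm ?divr_ge0// -[leRHS]mul1r ler_pM ?divr_ge0//.
by rewrite ler_pdivrMr// mul1r ler_nat.
Qed.

Definition fract {R : realType} (x : R) : R := x - (Num.floor x)%:~R.

Lemma fract_itv {R : realType} (x : R) : 0 <= fract x < 1.
Proof.
by have := floor_itv x; rewrite /fract intrD => /andP[h1 h2]; apply/andP; split; lra.
Qed.

Lemma measurable_fract {R : realType} : measurable_fun setT (@fract R).
Proof.
apply: measurable_funB => //; apply: nondecreasing_measurable => // x y xy.
by rewrite ler_int; exact: le_floor.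
Qed.

Lemma fractDl {R : realType} (x t : R) : 0 <= fract x + t < 1 -> fract (x + t) = fract x + t.
Proof.
move=> h; rewrite /fract (@floor_def _ _ (Num.floor x)); first by ring.
by move: h; rewrite /fract intrD => /andP[h1 h2]; apply/andP; split; lra.
Qed.

Lemma fractDl1 {R : realType} (x t : R) :
  1 <= fract x + t < 2 -> fract (x + t) = fract x + t - 1.
Proof.
move=> h; rewrite /fract (@floor_def _ _ (Num.floor x + 1)).
  by rewrite intrD; ring.
by move: h; rewrite /fract !intrD => /andP[h1 h2]; apply/andP; split; lra.
Qed.

(** Translation by the arc length carries each of the [N.+1] half-open arcs to the next and the last
    to the first, so their masses are almost equal; rounding [s] to an endpoint costs one arc
    length. *)
Lemma fract_almost_uniform {d} {T : measurableType d} {R : realType}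
    {P : probability T R} {V : T -> R} {N : nat} {eta : R} :
  measurable_fun setT V -> 0 <= eta ->
  (forall A : set R, measurable A ->
    P [set w | A (V w + N.+1%:R^-1)%R] <= P [set w | A (V w)] + eta%:E)%E ->
  forall s, 0 <= s <= 1 ->
  `|fine (P [set w | fract (V w) <= s]) - s| <= N.+1%:R^-1 + 2 * N.+1%:R ^+ 2 * eta.
Proof.
move=> mV eta0 shift s /andP[s0 s1].
have N0 : 0 < N.+1%:R :> R by rewrite ltr0n.
set h : R := N.+1%:R^-1; have h0 : 0 < h by rewrite invr_gt0.
have Nh : N.+1%:R * h = 1 by rewrite divff// gt_eqF.
have mf : measurable_fun setT (fun w => fract (V w)).
  by apply: measurableT_comp => //; exact: measurable_fract.
pose band r : set R := [set x | r%:R * h <= x < r.+1%:R * h].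
have mband r : measurable (band r).
  rewrite (_ : band r = `[r%:R * h, r.+1%:R * h[%classic); first exact: measurable_itv.
  by apply/seteqP; split => x /=; rewrite in_itv.
have mpre A : measurable A -> measurable [set w | A (fract (V w))].
  by move=> mA; rewrite -[X in measurable X]setTI; exact: mf.
pose p r := fine (P [set w | band r (fract (V w))]).
have pE r : P [set w | band r (fract (V w))] = (p r)%:E.
  by rewrite fineK// fin_num_measure//; exact: mpre.
pose H k := fine (P [set w | fract (V w) < k%:R * h]).
have mlt x : measurable [set w | fract (V w) < x].
  rewrite (_ : mkset _ = [set w | `]-oo, x[%classic (fract (V w))]).
    by apply: mpre; exact: measurable_itv.
  by apply/seteqP; split => w /=; rewrite in_itv.
have mle x : measurable [set w | fract (V w) <= x].
  rewrite (_ : mkset _ = [set w | `]-oo, x]%classic (fract (V w))]).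
    by apply: mpre; exact: measurable_itv.
  by apply/seteqP; split => w /=; rewrite in_itv.
have Psum k : H k = \sum_(r < k) p r.
  elim: k => [|k IHk].
    rewrite big_ord0 /H (_ : mkset _ = set0) ?measure0//.
    apply/seteqP; split => w //=; rewrite mul0r ltNge.
    by have /andP[-> _] := fract_itv (V w).
  rewrite big_ord_recr /= -IHk /H /p -fineD ?fin_num_measure//; last exact: mpre.
  rewrite -measureU//.
  - congr (fine (P _)); apply/seteqP; split => w /=; rewrite /band /=.
      by case: (ltP (fract (V w)) (k%:R * h)) => [|hk] hk'; [left|right].
    move=> [hk|/andP[]//]; apply: lt_trans hk _.
    by rewrite ltr_pM2r// ltr_nat.
  - exact: mpre.
  - apply/seteqP; split => w //= [hk]; rewrite /band /= => /andP[].
    by rewrite leNgt hk.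
have HN : \sum_(r < N.+1) p r = 1.
  rewrite -Psum /H (_ : mkset _ = setT) ?probability_setT//.
  by apply/seteqP; split => w //= _; rewrite Nh; have /andP[] := fract_itv (V w).
(* The shift hypothesis is used on the periodic set of reals whose fractional part lies in
   [band s']. *)
have stepP r s' : (forall x, band r (fract x) -> band s' (fract (x + h))) ->
    p r <= p s' + eta.
  move=> hb; rewrite -lee_fin EFinD -!pE.
  have mA : measurable [set x : R | band s' (fract x)].
    by rewrite -[X in measurable X]setTI; exact: measurable_fract.
  apply: le_trans (shift _ mA); apply: le_measure; rewrite ?inE.
  - exact: mpre.
  - rewrite -[X in measurable X]setTI.
    apply: (_ : measurable_fun setT (fun w => V w + h)) => //.
    exact: measurable_funD.
  - by move=> w /=; exact: hb.
have pS r : (r < N)%N -> p r <= p r.+1 + eta.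
  move=> rN; apply: stepP => x; rewrite /band /= => /andP[h1 h2].
  have h3 : r.+2%:R * h <= 1 by rewrite -[leRHS]Nh ler_pM2r// ler_nat.
  have e1 : r.+1%:R * h = r%:R * h + h by rewrite -natr1 mulrDl mul1r.
  have e2 : r.+2%:R * h = r.+1%:R * h + h by rewrite -natr1 mulrDl mul1r.
  have r0 : 0 <= r%:R * h by rewrite mulr_ge0// ltW.
  by rewrite fractDl; lra.
have pN : p N <= p 0%N + eta.
  apply: stepP => x; rewrite /band /= => /andP[h1 h2].
  have e1 : N.+1%:R * h = N%:R * h + h by rewrite -natr1 mulrDl mul1r.
  have h3 : h <= 1 by rewrite -[leRHS]Nh ler_peMl ?ler1n// ltW.
  by rewrite fractDl1; lra.
have close k : (k <= N.+1)%N -> `|H k - k%:R * h| <= 2 * N.+1%:R ^+ 2 * eta.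
  by move=> kN; rewrite Psum; exact: (cyclic_almost_uniform eta0 pS pN HN).
set e := 2 * _ * _ in close *.
have fle (A A' : set T) : measurable A -> measurable A' -> A `<=` A' ->
    fine (P A) <= fine (P A').
  move=> mA mA' AA'; apply: fine_le; rewrite ?fin_num_measure//.
  by apply: le_measure; rewrite ?inE.
set G := fine _.
have sN0 : 0 <= s * N.+1%:R by rewrite mulr_ge0.
have /andP[k1 k2] := truncn_itv sN0; set k := Num.truncn _ in k1 k2.
have ks : k%:R * h <= s by rewrite ler_pdivrMr.
have sk : s < k.+1%:R * h by rewrite ltr_pdivlMr.
have kN : (k <= N.+1)%N.
  by rewrite -(@ler_nat R) (le_trans k1)// ler_piMl.
have e1 : k.+1%:R * h = k%:R * h + h by rewrite -natr1 mulrDl mul1r.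
have low : H k <= G.
  by apply: fle => // w /= hw; apply/ltW/(lt_le_trans hw).
have e0 : 0 <= e by rewrite !mulr_ge0.
have := close _ kN; rewrite ler_distl => /andP[c1 c2].
rewrite ler_distl; apply/andP; split; first by lra.
(* [k = N.+1] occurs only for [s = 1], where no arc lies above and [G <= 1] replaces the comparison
   with [H k.+1]. *)
move: kN; rewrite leq_eqVlt => /predU1P[kN|kN].
  have : G <= 1 by rewrite -[leRHS]/(fine 1%E) fine_le ?fin_num_measure// probability_le1.
  by move: ks; rewrite kN Nh; lra.
have up : G <= H k.+1 by apply: fle => // w /= hw; exact: le_lt_trans sk.
by have := close _ kN; rewrite ler_distl => /andP[c3 c4]; lra.
Qed.

(** * Maxima, logarithms and significands *)

Lemma measurable_bigmaxr {d} {T : measurableType d} {R : realType} {I : Type}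
    (s : seq I) (Q : pred I) (f : I -> T -> R) :
  (forall i, Q i -> measurable_fun setT (f i)) ->
  measurable_fun setT (fun w => \big[Num.max/0]_(i <- s | Q i) f i w).
Proof.
move=> mf; elim: s => [|i s IHs].
  by under eq_fun do rewrite big_nil; exact: measurable_cst.
under eq_fun do rewrite big_cons.
case: (boolP (Q i)) => // Qi.
exact: measurable_maxr (mf _ Qi) IHs.
Qed.

Lemma powR_logB {R : realType} (B x : R) : 1 < B -> 0 < x -> B `^ logB B x = x.
Proof.
move=> B1 x0; have lB : 0 < ln B by exact: ln_gt0.
by rewrite /powR gt_eqF ?(lt_trans ltr01)// /logB divfK ?gt_eqF// lnK.
Qed.

Lemma logB_powRM {R : realType} (B t x : R) : 1 < B -> 0 < x ->
  logB B (B `^ t * x) = logB B x + t.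
Proof.
move=> B1 x0; have lB : 0 < ln B by exact: ln_gt0.
have B0 : 0 < B by exact: lt_trans B1.
rewrite /logB lnM ?posrE ?powR_gt0// ln_powR.
by field; rewrite gt_eqF.
Qed.

Lemma prod_powR_logB {R : realType} (B : R) n (x : nat -> R) : 1 < B ->
  (forall j, 0 < x j) -> \prod_(j < n) x j = B `^ (\sum_(j < n) logB B (x j)).
Proof.
move=> B1 x0; elim: n => [|n IHn]; first by rewrite !big_ord0 powRr0.
rewrite !big_ord_recr /= powRD ?powR_logB// ?IHn//.
by apply/implyP => _; rewrite gt_eqF ?(lt_trans ltr01).
Qed.

Lemma measurable_logB {R : realType} (B : R) : measurable_fun setT (logB B).
Proof. by apply: measurable_funM => //; exact: measurable_ln. Qed.

(** The significand is [B] to the power [fract (logB B x)] and [ln] is increasing; this moves the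
    Benford event to the circle. *)
Lemma significand_le {R : realType} (B x D : R) : 1 < B -> 1 <= D ->
  (significand B x <= D) = (fract (logB B x) <= logB B D).
Proof.
move=> B1 D1; have B0 : 0 < B by exact: lt_trans B1.
rewrite -ler_ln ?posrE ?powR_gt0//; last exact: lt_le_trans D1.
rewrite ln_powR -/(fract _).
by rewrite -ler_pdivlMr// ln_gt0.
Qed.

(** * Shifting the rows one at a time *)

Section rows.
Context {d} {T : measurableType d} {R : realType} {P : probability T R}.
Context {B : R} {m : nat} {a b : R} {hab : a < b} {X : 'I_m -> nat -> {RV P >-> R}}.
Hypothesis hB : 1 < B.
Hypothesis Xpos : forall i j w, 0 < X i j w.
Hypothesis Xind : mutually_independent P (fun ij : 'I_m * nat => (X ij.1 ij.2 : T -> R)).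
Hypothesis Xunif : forall i j, log_uniform P B hab (X i j).

Let Xf (ij : 'I_m * nat) : T -> R := X ij.1 ij.2.
Let L i j w := logB B (X i j w).

Let mX ij : measurable_fun setT (Xf ij).
Proof. exact: measurable_funPT. Qed.

(** The condition on [C] expresses dependence on the rows other than [i] only; it is asked for every
    such [J] because the coordinates to be conditioned on vary with the step of the walk. *)
Lemma row_shift {i : 'I_m} {C : T -> R} {t : R} {K : nat} :
  0 < t -> a + t + t <= b -> (0 < K)%N ->
  (forall J : {pred 'I_m * nat}, (forall p, p.1 != i -> p \in J) ->
    measurable_fun setT (C : g_sigma_algebraType (cylinders Xf J) -> R)) ->
  forall n (E : set (R * R)), measurable E ->
  (P [set w | E (C w, (\sum_(j < n) L i j w + t)%R)] <=
   P [set w | E (C w, (\sum_(j < n) L i j w)%R)] + (walk_bound (t / (b - a)) K n 1)%:E)%E.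
Proof.
move=> t0 atb K0 mC n E mE.
have mL j : measurable_fun setT (L i j).
  by apply: measurableT_comp; [exact: measurable_logB|exact: (mX (i, j))].
have mC' : measurable_fun setT C.
  by have [] := cylinders_fun_indep mX Xind (mC predT _).
have indep k (E' : set (R * R)) A : measurable E' -> measurable A ->
    (P ((fun w => (C w, (\sum_(j < k) L i j w)%R)) @^-1` E' `&` L i k @^-1` A) =
    P ((fun w => (C w, (\sum_(j < k) L i j w)%R)) @^-1` E') * uniform_prob hab A)%E.
  move=> mE' mA.
  (* All coordinates except [(i, k)]: they determine [C] and the earlier steps of row [i]. *)
  pose J : {pred 'I_m * nat} := [pred p | p != (i, k)].
  have mL' j : (j < k)%N ->
      measurable_fun setT (L i j : g_sigma_algebraType (cylinders Xf J) -> R).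
    move=> jk; apply: measurableT_comp; first exact: measurable_logB.
    apply: (measurable_cylinder_coord (i, j)).
    by rewrite inE xpair_eqE eqxx ltn_eqF.
  have mCJ : measurable_fun setT (C : g_sigma_algebraType (cylinders Xf J) -> R).
    by apply: mC => -[i' j'] /= ii; rewrite inE xpair_eqE (negbTE ii).
  have mW : measurable_fun setT
      ((fun w => (C w, \sum_(j < k) L i j w)) : g_sigma_algebraType (cylinders Xf J) -> _).
    apply: measurable_fun_pair => //; apply: measurable_sum => j.
    exact: mL'.
  have [_ ind] := cylinders_fun_indep mX Xind mW.
  have mlA : measurable (logB B @^-1` A).
    by rewrite -[X in measurable X]setTI; exact: measurable_logB.
  have := ind (i, k) _ _ _ mE' mlA; rewrite inE eqxx => /(_ isT).
  by rewrite -(Xunif i k)//; exact.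
have := walk_shift t0 atb mC' mL indep K0 n 1 E K0 mE.
by under [X in (P X <= _)%E -> _]eq_set do rewrite mul1r.
Qed.

Let M n w := \big[Num.max/0]_(i < m) \prod_(j < n) X i j w.

(** Scaling all rows by one factor scales the maximum and so adds [t] to its logarithm, while
    scaling a single row moves only its walk, the other rows entering through [C]. *)
Lemma max_prod_shift {t : R} {K : nat} :
  0 < t -> a + t + t <= b -> (0 < K)%N -> (0 < m)%N ->
  forall n (A : set R), measurable A ->
  (P [set w | A (logB B (M n w) + t)%R] <=
   P [set w | A (logB B (M n w))] +
   (m%:R * walk_bound (t / (b - a)) K n 1)%:E)%E.
Proof.
move=> t0 atb K0 m0 n A mA.
have B0 : 0 < B by exact: lt_trans hB.
set c := B `^ t; have c0 : 0 < c by rewrite powR_gt0.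
(* [Z e] is the maximum when only the first [e] rows are shifted. *)
pose term e (i : 'I_m) w := (if (i < e)%N then c else 1) * \prod_(j < n) X i j w.
pose Z e w := \big[Num.max/0]_(i < m) term e i w.
have stepZ e : (e < m)%N ->
    (P [set w | A (logB B (Z e.+1 w))] <=
     P [set w | A (logB B (Z e w))] + (walk_bound (t / (b - a)) K n 1)%:E)%E.
  move=> em; pose i0 := Ordinal em.
  pose C w := \big[Num.max/0]_(i < m | i != i0) term e i w.
  pose E := [set z : R * R | A (logB B (Num.max (B `^ z.2) z.1))].
  have mE : measurable E.
    rewrite -[X in measurable X]setTI.
    apply: (_ : measurable_fun setT
      (fun z : R * R => logB B (Num.max (B `^ z.2) z.1))) => //.
    have mB := measurableT_comp (measurable_powRr B) (@measurable_snd _ _ R R).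
    apply: (measurableT_comp (measurable_logB B)).
    exact: measurable_maxr mB measurable_fst.
  have ZE : Z e = fun w => Num.max (B `^ (\sum_(j < n) L i0 j w)) (C w).
    apply/funext => w; rewrite /Z (bigmaxD1 i0 xpredT)//; congr Num.max.
    by rewrite /term ltnn mul1r; apply: (prod_powR_logB B n (fun j => X i0 j w)).
  have ZSE : Z e.+1 = fun w => Num.max (B `^ (\sum_(j < n) L i0 j w + t)) (C w).
    apply/funext => w; rewrite /Z (bigmaxD1 i0 xpredT)//; congr Num.max.
      rewrite /term ltnSn powRD; last by apply/implyP => _; rewrite gt_eqF.
      by rewrite mulrC; congr (_ * _); apply: (prod_powR_logB B n (fun j => X i0 j w)).
    apply: eq_bigr => i ii0; rewrite /term ltnS leq_eqVlt.
    by rewrite (negbTE (ii0 : (i : nat) != e)).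
  have mC (J : {pred 'I_m * nat}) : (forall p, p.1 != i0 -> p \in J) ->
      measurable_fun setT (C : g_sigma_algebraType (cylinders Xf J) -> R).
    move=> hJ; apply: measurable_bigmaxr => i ii0.
    apply: measurable_funM => //; apply: measurable_prod => j _.
    by apply: (measurable_cylinder_coord (i, nat_of_ord j)); exact: hJ.
  rewrite ZE ZSE; exact: (row_shift t0 atb K0 mC n E mE).
move: (walk_bound _ _ _ _) stepZ => W stepZ.
have stepsZ e : (e <= m)%N ->
    (P [set w | A (logB B (Z e w))] <=
     P [set w | A (logB B (Z 0%N w))] + (e%:R * W)%:E)%E.
  elim: e => [|e IHe] em; first by rewrite mul0r adde0.
  apply: le_trans (stepZ _ em) _; rewrite -natr1 mulrDl mul1r EFinD addeA.
  by apply: leeD => //; exact/IHe/ltnW.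
have Z0E w : Z 0%N w = M n w.
  by apply: eq_bigr => i _; rewrite /term ltn0 mul1r.
(* A factor [c >= 0] commutes with [Num.max] and fixes its initial value [0]. *)
have ZmE w : Z m w = c * Z 0%N w.
  rewrite Z0E (big_morph _ (fun x y => maxr_pMr x y (ltW c0)) (mulr0 c)).
  by apply: eq_bigr => i _; rewrite /term ltn_ord.
(* As [m > 0], some positive row product beats the initial value [0], so the logarithm of the scaled
   maximum splits. *)
have Zpos w : 0 < Z 0%N w.
  rewrite Z0E /M (bigmaxD1 (Ordinal m0) xpredT)// lt_max; apply/orP; left.
  by apply: prodr_gt0.
have := stepsZ m (leqnn m).
under eq_set do rewrite ZmE logB_powRM// Z0E.
by under [X in (_ <= P X + _)%E -> _]eq_set do rewrite Z0E.
Qed.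

End rows.

(** * Choice of the parameters and passage to the limit *)

Theorem theorem1p9 (d : measure_display) (T : measurableType d) (R : realType)
  (P : probability T R) (B : R) (m : nat) (a b : R)
  (hB : 1 < B) (hm : (1 <= m)%N) (hab : a < b) (hb : b <= 0)
  (X : 'I_m -> nat -> {RV P >-> R})
  (Xpos : forall i j w, 0 < X i j w)
  (Xind : mutually_independent P (fun ij : 'I_m * nat => (X ij.1 ij.2 : T -> R)))
  (Xunif : forall i j, log_uniform P B hab (X i j)) :
  strong_Benford P B
    (fun n w => \big[Num.max/0]_(i < m) \prod_(j < n) X i j w).
Proof.
move=> D /andP[D1 DB].
have lB : 0 < ln B by exact: ln_gt0.
have B0 : 0 < B by exact: lt_trans hB.
set s := logB B D.
have s01 : 0 <= s <= 1.
  rewrite /s /logB; apply/andP; split; first by rewrite divr_ge0 ?ln_ge0// ltW.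
  rewrite ler_pdivrMr// mul1r.
  by rewrite ler_ln ?posrE// (lt_le_trans ltr01).
pose M n w := \big[Num.max/0]_(i < m) \prod_(j < n) X i j w.
have mM n : measurable_fun setT (fun w => logB B (M n w)).
  apply: measurableT_comp; first exact: measurable_logB.
  apply: measurable_bigmaxr => i _; apply: measurable_prod => j _.
  exact: measurable_funPT.
have ME n : [set w | significand B (M n w) <= D] = [set w | fract (logB B (M n w)) <= s].
  by apply/seteqP; split => w /=; rewrite significand_le.
have mS n : measurable [set w | fract (logB B (M n w)) <= s].
  rewrite (_ : mkset _ = (fun w => fract (logB B (M n w))) @^-1` `]-oo, s]).
    rewrite -[X in measurable X]setTI.
    by apply: (measurableT_comp measurable_fract (mM n)).
  by apply/seteqP; split => w /=; rewrite in_itv.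
apply/fine_cvgP; split.
  by apply: nearW => n; rewrite -/(M n _) ME fin_num_measure.
apply/cvgrPdist_le => eps e0.
have ba0 : 0 < b - a by rewrite subr_gt0.
have m0 : 0 < m%:R :> R by rewrite ltr0n.
(* The two summands give [t <= eps / 2] for the rounding error and [t <= (b - a) / 2], so that two
   cells of length [t] fit between [a] and [b]. *)
pose N := Num.truncn (2 / eps + 2 / (b - a)).
have N0 : 0 < N.+1%:R :> R by rewrite ltr0n.
have hN : 2 / eps + 2 / (b - a) < N.+1%:R by exact: truncnS_gt.
set t : R := N.+1%:R^-1; have t0 : 0 < t by rewrite invr_gt0.
have e20 : 0 < 2 / eps by rewrite divr_gt0.
have ba20 : 0 < 2 / (b - a) by rewrite divr_gt0.
have te : t <= eps / 2.
  rewrite /t -[leRHS]invrK lef_pV2 ?posrE ?invr_gt0 ?divr_gt0// invf_div; lra.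
have tba : t <= (b - a) / 2.
  rewrite /t -[leRHS]invrK lef_pV2 ?posrE ?invr_gt0 ?divr_gt0// invf_div; lra.
have q0 : 0 < t / (b - a) by rewrite divr_gt0.
have q12 : 2 * (t / (b - a)) <= 1 by rewrite mulrA ler_pdivrMr// mul1r; lra.
have atb : a + t + t <= b by lra.
have c0 : 0 < 2 * N.+1%:R ^+ 2 * m%:R :> R by rewrite !mulr_gt0// exprn_gt0.
(* With this accuracy for one row, the error from all [m] rows, multiplied by [2 * N.+1 ^ 2], is at
   most [eps / 2]. *)
have d0 : 0 < eps / 2 / (2 * N.+1%:R ^+ 2 * m%:R) by rewrite !divr_gt0.
have [K K0 hK] := walk_bound1_small q0 q12 d0.
apply: filterS hK => n hn; rewrite distrC /= -/(M n _) ME.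
have w0 : 0 <= walk_bound (t / (b - a)) K n 1 by apply: walk_bound_ge0 => //; exact: ltW.
apply: le_trans (fract_almost_uniform (mM n)
  (mulr_ge0 (ltW m0) w0) _ _ s01) _.
  by move=> A mA; exact: (max_prod_shift hB Xpos Xind Xunif t0 atb K0 hm n A mA).
rewrite -/t [leRHS]splitr; apply: lerD => //.
by rewrite mulrA mulrC -ler_pdivlMr.
Qed.
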